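(* Let $p\ge 1$, let $\Gamma:\Omega\to\mathcal{K}_c(\mathbb{R}^p)$ be a compact convex random set on a probability space $(\Omega,\mathcal{A},\mathbb{P})$, and let $K\in\mathcal{K}_c(\mathbb{R}^p)$ maximize $D_{CT}(\cdot;\Gamma)$ over $\mathcal{K}_c(\mathbb{R}^p)$. Then: (a) for every $L\in\mathcal{K}_c(\mathbb{R}^p)$ with $L\ne\{0\}$, $\lim_{n\to\infty}D_{CT}(K+n\cdot L;\Gamma)=0$; (b) for every sequence $\{K_n\}_n$ in $\mathcal{K}_c(\mathbb{R}^p)$ with $\lim_{n\to\infty}d_{\mathcal{H}}(K,K_n)=\infty$, $\lim_{n\to\infty}D_{CT}(K_n;\Gamma)=0$.
   Context: $\mathcal{K}_c(\mathbb{R}^p)$ denotes the set of non-empty compact convex subsets of $\mathbb{R}^p$, and $\mathbb{S}^{p-1}=\{x\in\mathbb{R}^p:\|x\|=1\}$ the Euclidean unit sphere. The support function of $K\in\mathcal{K}_c(\mathbb{R}^p)$ is $s_K:\mathbb{S}^{p-1}\to\mathbb{R}$, $s_K(u)=\sup_{k\in K}\langle k,u\rangle$. For $K,L\in\mathcal{K}_c(\mathbb{R}^p)$ and $\gamma\ge 0$, $K+L=\{k+l:k\in K,l\in L\}$ and $\gamma\cdot K=\{\gamma k:k\in K\}$. The Hausdorff distance is $d_{\mathcal{H}}(K,L)=\max\{\sup_{k\in K}\inf_{l\in L}\|k-l\|,\ \sup_{l\in L}\inf_{k\in K}\|k-l\|\}$. A map $\Gamma:\Omega\to\mathcal{K}_c(\mathbb{R}^p)$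 on a probability space $(\Omega,\mathcal{A},\mathbb{P})$ is a compact convex random set if $\{\omega\in\Omega:\Gamma(\omega)\cap K\ne\emptyset\}\in\mathcal{A}$ for all $K\in\mathcal{K}_c(\mathbb{R}^p)$; equivalently, it is Borel measurable with respect to the Hausdorff metric. For $u\in\mathbb{S}^{p-1}$, $t\in\mathbb{R}$, define the halfspaces $S^-_{u,t}=\{K\in\mathcal{K}_c(\mathbb{R}^p):s_K(u)\le t\}$ and $S^+_{u,t}=\{K\in\mathcal{K}_c(\mathbb{R}^p):s_K(u)\ge t\}$. The Tukey depth of $K\in\mathcal{K}_c(\mathbb{R}^p)$ with respect to $\Gamma$ is $$D_{CT}(K;\Gamma)=\min\Big\{\inf_{u\in\mathbb{S}^{p-1},\,t\in\mathbb{R}:\ K\in S^-_{u,t}}\mathbb{P}(\Gamma\in S^-_{u,t}),\ \inf_{u\in\mathbb{S}^{p-1},\,t\in\mathbb{R}:\ K\in S^+_{u,t}}\mathbb{P}(\Gamma\in S^+_{u,t})\Big\}.$$ *)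

(* Defs.v *)
From HB Require Import structures.
From mathcomp Require Import all_boot all_order all_algebra.
From mathcomp Require Import all_classical all_reals all_analysis.

Set Implicit Arguments.
Unset Strict Implicit.
Unset Printing Implicit Defensive.

Import Order.TTheory GRing.Theory Num.Theory.
Import numFieldNormedType.Exports.

Local Open Scope classical_set_scope.
Local Open Scope ring_scope.

Section convex_bodies.
Context {R : realType} {p : nat}.
Implicit Types (u v : 'rV[R]_p) (K L : set 'rV[R]_p).

(* The library's norm on row vectors is the sup norm, so the Euclidean
   structure is introduced here; both norms induce the same topology. *)
Definition inner u v : R := \sum_(i < p) u ord0 i * v ord0 i.

Definition enorm u : R := Num.sqrt (inner u u).

Definition esphere : set 'rV[R]_p := [set u | enorm u = 1].

Definition convex_bodies : set (set 'rV[R]_p) :=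
  [set K : set 'rV[R]_p | [/\ K !=set0, compact K & convex_set K]].

(* The real-valued [sup] and [inf] below are only meaningful for nonempty
   bounded families, which is the case when K and L are in [convex_bodies]. *)
Definition support_fun K u : R := sup [set inner k u | k in K].

Definition minkowski_sum K L : set 'rV[R]_p := [set k + l | k in K & l in L].

Definition dilation (c : R) K : set 'rV[R]_p := [set c *: k | k in K].

Definition hausdorff_dist K L : R :=
  Num.max (sup [set inf [set enorm (k - l) | l in L] | k in K])
          (sup [set inf [set enorm (k - l) | k in K] | l in L]).

Definition halfspace_le u (t : R) : set (set 'rV[R]_p) :=
  [set K : set 'rV[R]_p | convex_bodies K /\ support_fun K u <= t].

Definition halfspace_ge u (t : R) : set (set 'rV[R]_p) :=
  [set K : set 'rV[R]_p | convex_bodies K /\ t <= support_fun K u].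

End convex_bodies.

Section random_sets.
Context {R : realType} {p : nat} {d : measure_display} {Omega : measurableType d}.

Definition compact_convex_random_set (Gamma : Omega -> set 'rV[R]_p) : Prop :=
  (forall w, convex_bodies (Gamma w)) /\
  (forall K, convex_bodies K -> measurable [set w | Gamma w `&` K !=set0]).

Definition tukey_depth (P : probability Omega R)
    (Gamma : Omega -> set 'rV[R]_p) (K : set 'rV[R]_p) : \bar R :=
  Order.min
    (ereal_inf [set P (Gamma @^-1` halfspace_le ut.1 ut.2) | ut in
       [set ut : 'rV[R]_p * R | esphere ut.1 /\ halfspace_le ut.1 ut.2 K]])
    (ereal_inf [set P (Gamma @^-1` halfspace_ge ut.1 ut.2) | ut in
       [set ut : 'rV[R]_p * R | esphere ut.1 /\ halfspace_ge ut.1 ut.2 K]]).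

End random_sets.

(* Main.v *)
Require Import Defs.
From HB Require Import structures.
From mathcomp Require Import all_boot all_order all_algebra.
From mathcomp Require Import all_classical all_reals all_analysis.

Import Order.TTheory GRing.Theory Num.Theory.
Import numFieldNormedType.Exports.

Local Open Scope classical_set_scope.
Local Open Scope ring_scope.

(** The depth of a convex body is small as soon as the body reaches far out in
some direction.  If K has a point k with <k, u> >= t, then K lies in the
halfspace S^+_{u,t}, so D_CT(K; Gamma) <= P(Gamma in S^+_{u,t}).  For a fixed
direction u these probabilities tend to 0 as t grows: the events decrease, and
their intersection is empty because each value of Gamma has a finite support
function ([halfspace_ge_prob_cvg0]).

To make this uniform in u, only the 2p directions +e_i and -e_i are used.  A
point k always has some coordinate of absolute value equal to its sup norm, so
some signed basis vector u satisfies <k, u> = `|k|; a maximum of finitely many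
sequences tending to 0 still tends to 0.  Hence the depth of any sequence of
convex bodies that leaves every ball tends to 0 ([tukey_depth_cvg0]), and both
claims reduce to this: K + n L contains k + n l with l != 0, and two sets
contained in fixed balls are at bounded Hausdorff distance
([hausdorff_dist_le_norm]).

The one measure-theoretic point is that Gamma in S^+_{u,t} is an event, while
the definition of a random set only speaks of hitting convex bodies.  By
compactness, Gamma in S^+_{u,t} means that Gamma hits the closed halfspace
{k | t <= <k, u>}, which is the countable union of its compact convex slices
by balls of integer radius ([measurable_halfspace_ge]). *)

(** * Convex bodies and their support functions *)

Section geometry.
Context {R : realType} {p : nat}.
Implicit Types (k l u v : 'rV[R]_p) (A K L : set 'rV[R]_p).

Lemma inner_addl k l u : inner (k + l) u = inner k u + inner l u.
Proof. by rewrite /inner -big_split; apply: eq_bigr => i _; rewrite mxE mulrDl. Qed.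

Lemma inner_scalel (a : R) k u : inner (a *: k) u = a * inner k u.
Proof. by rewrite /inner mulr_sumr; apply: eq_bigr => i _; rewrite mxE mulrA. Qed.

Lemma inner_continuous u : continuous (fun k => inner k u).
Proof.
apply: (continuous_big add_continuous) => i _ k.
by apply: cvgM; [exact: nbhs_filter|exact: coord_continuous|exact: cst_continuous].
Qed.

Lemma coord_le_norm k i : `|k ord0 i| <= `|k|.
Proof.
rewrite /Num.norm/= mx_normrE.
exact: (le_bigmax _ (fun ij : 'I_1 * 'I_p => `|k ij.1 ij.2|) (ord0, i)).
Qed.

(** The constant is the Euclidean norm of the all-ones vector; it compares the
Euclidean distance with the sup norm. *)
Lemma enorm_le_norm k : enorm k <= Num.sqrt p%:R * `|k|.
Proof.
rewrite -[`|k|]ger0_norm// -sqrtr_sqr -sqrtrM ?ler0n//; apply: ler_wsqrtr.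
rewrite /inner mulr_natl -[X in _ *+ X]card_ord -sumr_const.
apply: ler_sum => i _; rewrite -expr2 -real_normK ?num_real//.
by rewrite lerXn2r ?nnegrE// coord_le_norm.
Qed.

(** The signed standard basis vectors: the sign is negative when the boolean is
true, as in [(-1) ^+ b]. *)
Definition axis (ib : 'I_p * bool) : 'rV[R]_p := (-1) ^+ ib.2 *: delta_mx 0 ib.1.

Lemma inner_axis k ib : inner k (axis ib) = (-1) ^+ ib.2 * k ord0 ib.1.
Proof.
rewrite /inner (bigD1 ib.1)//= big1 => [|j jNi].
  by rewrite addr0 !mxE !eqxx mulr1 mulrC.
by rewrite !mxE (negbTE jNi) andbF !mulr0.
Qed.

Lemma axis_esphere ib : esphere (axis ib).
Proof.
rewrite /esphere/= /enorm inner_axis !mxE !eqxx mulr1.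
by rewrite -expr2 sqrr_sign sqrtr1.
Qed.

(** The sup norm is attained by the absolute value of a coordinate, that is, by
the pairing with one of finitely many unit vectors.  This is what replaces the
direction k / |k|, which would range over the whole sphere. *)
Lemma norm_eq_inner_axis k : k != 0 -> exists ib, `|k| = inner k (axis ib).
Proof.
move=> k0; have [|[i j] kij] := @mx_norm_neq0 _ _ _ k.
  by apply: contra k0 => /eqP/mx_norm_eq0 ->.
exists (j, k ord0 j < 0); rewrite inner_axis/= {1}/Num.norm/= kij/= (ord1 i).
by rewrite -normrEsign ?num_real.
Qed.

(** Convexity with the two weights as plain reals, so that the identities of
vector algebra apply directly. *)
Lemma convex_setE A :
  convex_set A <-> forall k l (a b : R), 0 <= a -> 0 <= b -> a + b = 1 ->
    A k -> A l -> A (a *: k + b *: l).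
Proof.
split=> [cA k l a b a0 b0 ab1 Ak Al|cA k l t]; last first.
  rewrite !inE => Ak Al; apply: cA => //; first exact: unstable.onem_ge0.
  by rewrite /unstable.onem addrC subrK.
have a1 : a <= 1 by rewrite -ab1 lerDl.
have := cA k l (Itv01 a0 a1); rewrite !inE => /(_ Ak Al).
by have -> : b = unstable.onem a by rewrite /unstable.onem -ab1 addrC addKr.
Qed.

Lemma inner_convex_body_max K u : convex_bodies K ->
  exists2 k, K k & forall l, K l -> inner l u <= inner k u.
Proof.
move=> [K0 cK _]; have [|k] := @EVT_max_rV _ _ (fun k => inner k u) K K0 cK.
  by apply: continuous_subspaceT; exact: inner_continuous.
rewrite inE => Kk kmax; exists k => // l Kl; apply: kmax; exact/mem_set.
Qed.

(** The support function is a maximum on a compact set, so a lower bound on it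
is a statement about hitting a closed halfspace of vectors. *)
Lemma halfspace_ge_hits K u t : convex_bodies K ->
  halfspace_ge u t K <-> exists2 k, K k & t <= inner k u.
Proof.
move=> bK; have [m Km mmax] := inner_convex_body_max K u bK.
have ubK : has_ubound [set inner k u | k in K].
  by exists (inner m u) => _ [k Kk <-]; exact: mmax.
split=> [[_ tK]|[k Kk tk]].
  exists m => //; apply: le_trans tK _.
  by apply: ge_sup => [|_ [k Kk <-]]; [exists (inner m u), m|exact: mmax].
by split=> //; apply: le_trans tk _; apply: ub_le_sup => //; exists k.
Qed.

Lemma halfspace_slice_convex_body u t (r : R) :
  let A := [set k | t <= inner k u /\ `|k| <= r] in
  A !=set0 -> convex_bodies A.
Proof.
move=> A A0; split=> //.
  apply: bounded_closed_compact.
    exists r; split; first exact: num_real.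
    by move=> M rM k [_ kr]; exact: le_trans kr (ltW rM).
  have -> : A = [set k | t <= inner k u] `&` [set k | `|k| <= r] by [].
  apply: closedI.
    apply: (@closed_comp _ _ (fun k => inner k u) [set x | t <= x]).
      by move=> k _; exact: inner_continuous.
    exact: closed_ge.
  apply: (@closed_comp _ _ (fun k => `|k|) [set x | x <= r]).
    by move=> k _; exact: norm_continuous.
  exact: closed_le.
apply/convex_setE => k l a b a0 b0 ab1 [tk kr] [tl lr]; split.
  rewrite inner_addl !inner_scalel -[t]mul1r -ab1 mulrDl.
  by apply: lerD; exact: ler_wpM2l.
apply: le_trans (ler_normD _ _) _; rewrite !normrZ !ger0_norm//.
by rewrite -[r]mul1r -ab1 mulrDl; apply: lerD; exact: ler_wpM2l.
Qed.

Lemma minkowski_sum_convex_body K L :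
  convex_bodies K -> convex_bodies L -> convex_bodies (minkowski_sum K L).
Proof.
move=> [[k0 Kk0] cK /convex_setE vK] [[l0 Ll0] cL /convex_setE vL]; split.
- by exists (k0 + l0), k0 => //; exists l0.
- have -> : minkowski_sum K L = (fun kl => kl.1 + kl.2) @` (K `*` L).
    rewrite eqEsubset; split=> x.
      by move=> [k Kk [l Ll <-]]; exists (k, l).
    by move=> [[k l] [Kk Ll] <-]; exists k => //; exists l.
  apply: continuous_compact; last exact: compact_setX.
  by apply: continuous_subspaceT => kl; exact: add_continuous.
apply/convex_setE => _ _ a b a0 b0 ab1 [k Kk [l Ll <-]] [k' Kk' [l' Ll' <-]].
exists (a *: k + b *: k'); first exact: vK.
exists (a *: l + b *: l'); first exact: vL.
by rewrite !scalerDr addrACA.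
Qed.

Lemma dilation_convex_body (c : R) K :
  convex_bodies K -> convex_bodies (dilation c K).
Proof.
move=> [[k0 Kk0] cK /convex_setE vK]; split.
- by exists (c *: k0), k0.
- apply: continuous_compact => //.
  by apply: continuous_subspaceT => k; exact: scaler_continuous.
apply/convex_setE => _ _ a b a0 b0 ab1 [k Kk <-] [l Kl <-].
exists (a *: k + b *: l); first exact: vK.
by rewrite scalerDr !scalerA ![c * _]mulrC.
Qed.

(** For nonempty sets, every infimum in the Hausdorff distance is at most the
distance to one chosen point, so the largest pairwise distance is a bound. *)
Lemma hausdorff_dist_le (M : R) K L : K !=set0 -> L !=set0 ->
  (forall k l, K k -> L l -> enorm (k - l) <= M) -> hausdorff_dist K L <= M.
Proof.
move=> [k0 Kk0] [l0 Ll0] KLM.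
rewrite /hausdorff_dist ge_max; apply/andP; split.
  apply: ge_sup; first by eexists; exists k0.
  move=> _ [k Kk <-]; apply: le_trans (KLM k l0 Kk Ll0).
  by apply: ge_inf; [exists 0 => _ [l _ <-]; exact: sqrtr_ge0|exists l0].
apply: ge_sup; first by eexists; exists l0.
move=> _ [l Ll <-]; apply: le_trans (KLM k0 l Kk0 Ll).
by apply: ge_inf; [exists 0 => _ [k _ <-]; exact: sqrtr_ge0|exists k0].
Qed.

Lemma hausdorff_dist_le_norm (a b : R) K L : K !=set0 -> L !=set0 ->
  (forall k, K k -> `|k| <= a) -> (forall l, L l -> `|l| <= b) ->
  hausdorff_dist K L <= Num.sqrt p%:R * (a + b).
Proof.
move=> K0 L0 Ka Lb; apply: hausdorff_dist_le => // k l Kk Ll.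
apply: le_trans (enorm_le_norm _) _; apply: ler_wpM2l => //.
by apply: le_trans (ler_normB _ _) _; apply: lerD; [exact: Ka|exact: Lb].
Qed.

End geometry.

(** * Tukey depth of bodies that leave every ball *)

Section depth.
Context {R : realType} {p : nat} {d : measure_display} {Omega : measurableType d}.
Context (P : probability Omega R) (Gamma : Omega -> set 'rV[R]_p).
Context (hGamma : compact_convex_random_set Gamma).

Lemma measurable_halfspace_ge u (t : R) :
  measurable (Gamma @^-1` halfspace_ge u t).
Proof.
have [bG mG] := hGamma.
have -> : Gamma @^-1` halfspace_ge u t = \bigcup_(n in setT)
    [set w | Gamma w `&` [set k | t <= inner k u /\ `|k| <= n%:R] !=set0].
  (* the radius of the slice is any integer above the norm of a point hit *)
  rewrite eqEsubset; split=> w /=.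
    move=> /(halfspace_ge_hits (Gamma w) u t (bG w))[k Gk tk].
    exists (Num.truncn `|k|).+1 => //; exists k; split=> //; split=> //.
    by apply: ltW; exact: truncnS_gt.
  move=> [n _ [k [Gk [tk _]]]].
  by apply/(halfspace_ge_hits (Gamma w) u t (bG w)); exists k.
apply: bigcup_measurable => n _.
have [A0|A0] := pselect ([set k | t <= inner k u /\ `|k| <= n%:R] !=set0).
  by apply: mG; exact: halfspace_slice_convex_body.
(* an empty slice is not a convex body, but no set hits it *)
rewrite (_ : mkset _ = set0)//; apply/seteqP; split=> // w [k [_ kA]].
by apply: A0; exists k.
Qed.

(** Continuity from above of P: a set in S^+_{u,n} for all n would have an
infinite support function at u. *)
Lemma halfspace_ge_prob_cvg0 u :
  (fun n => P (Gamma @^-1` halfspace_ge u n%:R)) @ \oo --> 0%E.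
Proof.
pose F n := Gamma @^-1` halfspace_ge u n%:R.
have F0 : \bigcap_n F n = set0.
  apply/seteqP; split=> // w Fw.
  have [_] := Fw (Num.truncn (support_fun (Gamma w) u)).+1 I.
  by rewrite leNgt truncnS_gt.
rewrite -(measure0 P) -F0; apply: nonincreasing_cvg_mu.
- exact: le_lt_trans (probability_le1 P (measurable_halfspace_ge _ _)) (ltry _).
- by move=> n; exact: measurable_halfspace_ge.
- by rewrite F0; exact: measurable0.
- move=> m n mn; apply/subsetPset => w [bw nw]; split=> //.
  by apply: le_trans nw; rewrite ler_nat.
Qed.

Lemma tukey_depth_ge0 K : (0 <= tukey_depth P Gamma K)%E.
Proof.
by rewrite /tukey_depth le_min; apply/andP; split;
  apply: le_ereal_inf_tmp => _ [ut _ <-].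
Qed.

Lemma tukey_depth_le K u (t : R) : esphere u -> halfspace_ge u t K ->
  (tukey_depth P Gamma K <= P (Gamma @^-1` halfspace_ge u t))%E.
Proof.
move=> u1 Kut; rewrite /tukey_depth ge_min; apply/orP; right.
by apply: ereal_inf_lbound; exists (u, t).
Qed.

(** Once one level m makes all 2p halfspaces S^+_{u,m} of signed basis vectors
u unlikely, every body with a point of norm at least m has small depth. *)
Lemma tukey_depth_cvg0 (Kn : nat -> set 'rV[R]_p) :
  (forall n, convex_bodies (Kn n)) ->
  (forall M : R, \forall n \near \oo, exists2 k, Kn n k & M <= `|k|) ->
  (fun n => tukey_depth P Gamma (Kn n)) @ \oo --> 0%E.
Proof.
move=> bKn KnM.
have small (e : R) : 0 < e ->
    \forall n \near \oo, (tukey_depth P Gamma (Kn n) < e%:E)%E.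
  move=> e0.
  (* m > 0 excludes k = 0, which attains its norm along no axis when p = 0 *)
  have [m [m0 Pm]] : exists m : nat, 0 < m%:R :> R /\ forall ib : 'I_p * bool,
      (P (Gamma @^-1` halfspace_ge (axis ib) m%:R) < e%:E)%E.
    near \oo => m; exists m; split.
      by rewrite ltr0n; near: m; exists 1.
    near: m; apply: filter_forall => ib.
    have e_nbhs : nbhs (0%E : \bar R) [set x | (x < e%:E)%E].
      by apply: open_nbhs_nbhs; split; [exact: open_ereal_lt_ereal|rewrite /= lte_fin].
    exact: (halfspace_ge_prob_cvg0 (axis ib) _ e_nbhs).
  apply: filterS (KnM m%:R) => n [k Knk mk].
  have [|ib kib] := @norm_eq_inner_axis _ _ k.
    by rewrite -normr_gt0; exact: lt_le_trans m0 mk.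
  apply: le_lt_trans (Pm ib); apply: tukey_depth_le.
    exact: axis_esphere.
  by apply/(halfspace_ge_hits _ _ _ (bKn n)); exists k; rewrite // -kib.
have fin n : (tukey_depth P Gamma (Kn n) < +oo)%E ->
    tukey_depth P Gamma (Kn n) \is a fin_num.
  by move=> D; rewrite ge0_fin_numE ?tukey_depth_ge0.
apply/fine_cvgP; split.
  apply: filterS (small 1 ltr01) => n D1.
  by apply: fin; apply: lt_trans D1 (ltry _).
apply/cvgr0Pnorm_lt => e /small; apply: filterS => n De.
rewrite /= ger0_norm ?fine_ge0 ?tukey_depth_ge0// -lte_fin fineK//.
by apply: fin; apply: lt_trans De (ltry _).
Unshelve. all: by end_near. Qed.

End depth.

Theorem proposition4p7 (R : realType) (p : nat) (hp : (1 <= p)%N)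
    (d : measure_display) (Omega : measurableType d) (P : probability Omega R)
    (Gamma : Omega -> set 'rV[R]_p) (hGamma : compact_convex_random_set Gamma)
    (K : set 'rV[R]_p) (hK : convex_bodies K)
    (hmax : forall L : set 'rV[R]_p, convex_bodies L ->
      (tukey_depth P Gamma L <= tukey_depth P Gamma K)%E) :
  (forall L : set 'rV[R]_p, convex_bodies L -> L <> [set 0] ->
     (fun n : nat =>
        tukey_depth P Gamma (minkowski_sum K (dilation n%:R L))) @ \oo --> 0%E)
  /\
  (forall Kn : nat -> set 'rV[R]_p, (forall n, convex_bodies (Kn n)) ->
     (fun n : nat => hausdorff_dist K (Kn n)) @ \oo --> +oo ->
     (fun n : nat => tukey_depth P Gamma (Kn n)) @ \oo --> 0%E).
Proof.
have [[k Kk] cK _] := hK.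
split=> [L bL LN0|Kn bKn].
  have [l Ll l0] : exists2 l, L l & l != 0.
    apply: contra_notP LN0 => L0.
    have [[m Lm] _ _] := bL.
    have LE l : L l -> l = 0.
      by move=> Ll; apply/eqP; apply: contra_notT L0 => l0; exists l.
    by apply/seteqP; split=> [l /LE//|_ ->]; rewrite -(LE m Lm).
  apply: tukey_depth_cvg0 => // [n|M].
    exact/minkowski_sum_convex_body/dilation_convex_body.
  near=> n; exists (k + n%:R *: l).
    by exists k => //; exists (n%:R *: l) => //; exists l.
  rewrite addrC; apply: le_trans (lerB_normD _ _).
  rewrite normrZ normr_nat lerBrDr -ler_pdivrMr ?normr_gt0//.
  by near: n; exact: nbhs_infty_ger.
move=> /cvgryPgt dKn; apply: tukey_depth_cvg0 => // M.
have [r [_ Kr]] := compact_bounded cK.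
apply: filterS (dKn (Num.sqrt p%:R * ((r + 1) + M))) => n; have [Kn0 _ _] := bKn n.
rewrite ltNge; apply: contraNP => KnM; apply: hausdorff_dist_le_norm => //.
- by exists k.
- by apply: Kr; rewrite ltrDl.
- by move=> l Knl; rewrite leNgt; apply/negP => /ltW Ml; apply: KnM; exists l.
Unshelve. all: by end_near. Qed.
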